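(* Let $k\ge 2$ and let $n_1\ge n_2\ge\dots\ge n_k$ be positive integers, and let $N=\sum_{i=1}^k n_i$. Then $$S(L_{n_1}\vee L_{n_2}\vee K_{n_3}\vee K_{n_4}\vee\dots\vee K_{n_k})=2N-n_1-n_2-1.$$ (For $k=2$ the graph is $L_{n_1}\vee L_{n_2}$.)
   Context: For a finite simple graph $G=(V,E)$ and an injective map $f:V\to\mathbb Z$, let $\sigma(G,f)=\{f(v)+f(w): vw\in E\}$. The sum index of $G$ is $S(G)=\min_{f}|\sigma(G,f)|$ over all injective $f:V\to\mathbb Z$. For a positive integer $n$, $L_n$ is the graph with vertex set $\{v_1,\dots,v_n\}$ and edge set $\{v_iv_j: i,j\in[1,n],\ i\ne j,\ i+j\ge n+2\}$. $K_m$ is the complete graph on $m$ vertices. For graphs $G_1,G_2$ (on disjoint vertex sets), the join $G_1\vee G_2$ is obtained from their disjoint union by adding all edges between a vertex of $G_1$ and a vertex of $G_2$. *)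

(* Defs.v *)
(* Classical logic only serves to take a minimum over all labelings. *)
From HB Require Import structures.
From mathcomp Require Import all_boot all_order all_algebra.
From mathcomp Require Import finmap boolp.

Set Implicit Arguments.
Unset Strict Implicit.
Unset Printing Implicit Defensive.

Import Order.TTheory GRing.Theory Num.Theory.

Record sgraph := SGraph {
  vertex :> finType;
  adj : rel vertex;
  adj_sym : symmetric adj;
  adj_irr : irreflexive adj
}.

Definition edge_sums (G : sgraph) (f : G -> int) : {fset int} :=
  seq_fset tt [seq (f e.1 + f e.2)%R | e : G * G in [pred e | adj e.1 e.2]].

Definition edge_sum_count (G : sgraph) : pred nat :=
  fun s => `[< exists2 f : G -> int, injective f & #|` edge_sums f| = s >].

Lemma edge_sum_count_ex (G : sgraph) : exists s, edge_sum_count G s.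
Proof.
exists #|` edge_sums (fun v : G => Posz (enum_rank v))|.
apply/asboolP; exists (fun v : G => Posz (enum_rank v)) => //.
by move=> v w [] /val_inj /enum_rank_inj.
Qed.

Definition sum_index (G : sgraph) : nat := ex_minn (edge_sum_count_ex G).

Lemma sum_index_attained (G : sgraph) :
  exists2 f : G -> int, injective f & #|` edge_sums f| = sum_index G.
Proof. by rewrite /sum_index; case: ex_minnP => s /asboolP. Qed.

Lemma sum_index_le (G : sgraph) (f : G -> int) :
  injective f -> sum_index G <= #|` edge_sums f|.
Proof.
move=> f_inj; rewrite /sum_index; case: ex_minnP => s _; apply.
by apply/asboolP; exists f.
Qed.

Lemma mem_edge_sums (G : sgraph) (f : G -> int) (x : int) :
  reflect (exists v w : G, adj v w /\ x = (f v + f w)%R) (x \in edge_sums f).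
Proof.
rewrite seq_fsetE; apply: (iffP imageP) => [[[v w] vw ->]|[v [w [vw ->]]]].
  by exists v, w.
by exists (v, w).
Qed.

(* The ordinal i : 'I_n stands for the vertex v_(i+1), hence the shifts. *)
Definition L_adj (n : nat) : rel 'I_n :=
  fun i j => (i != j) && (n + 2 <= i.+1 + j.+1).

Lemma L_adj_sym n : symmetric (@L_adj n).
Proof. by move=> i j; rewrite /L_adj eq_sym [i.+1 + _]addnC. Qed.

Lemma L_adj_irr n : irreflexive (@L_adj n).
Proof. by move=> i; rewrite /L_adj eqxx. Qed.

Definition L_graph (n : nat) : sgraph := SGraph (@L_adj_sym n) (@L_adj_irr n).

Definition complete_adj (n : nat) : rel 'I_n := fun i j => i != j.

Lemma complete_adj_sym n : symmetric (@complete_adj n).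
Proof. by move=> i j; rewrite /complete_adj eq_sym. Qed.

Lemma complete_adj_irr n : irreflexive (@complete_adj n).
Proof. by move=> i; rewrite /complete_adj eqxx. Qed.

Definition complete_graph (n : nat) : sgraph :=
  SGraph (@complete_adj_sym n) (@complete_adj_irr n).

Definition join_adj (G H : sgraph) : rel (G + H)%type :=
  fun x y => match x, y with
  | inl u, inl v => adj u v
  | inr u, inr v => adj u v
  | _, _ => true
  end.

Lemma join_adj_sym (G H : sgraph) : symmetric (@join_adj G H).
Proof. by move=> [u|u] [v|v] //=; apply: adj_sym. Qed.

Lemma join_adj_irr (G H : sgraph) : irreflexive (@join_adj G H).
Proof. by move=> [u|u] /=; apply: adj_irr. Qed.

Definition graph_join (G H : sgraph) : sgraph :=
  SGraph (@join_adj_sym G H) (@join_adj_irr G H).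

(* Main.v *)
(* Label L_a by 0, ..., a-1 in the order of its vertices, the cliques by the
   following integers, and L_b by the top b integers in reverse order.  Then
   two distinct vertices are adjacent exactly when their labels sum to at least
   a and at most 2N - b - 2, so this labeling has at most 2N - a - b - 1 edge
   sums.  For the lower bound keep only the edges that do not join two vertices
   of L_a or two vertices of L_b, and delete the vertex x with the largest label.
   If x lies in L_a, which has another vertex, its sum with the largest label
   outside L_a exceeds all remaining sums; if x is adjacent to every other
   vertex, its sums with the next two labels do. *)
Require Import Defs.
From HB Require Import structures.
From mathcomp Require Import all_boot all_order all_algebra.
From mathcomp Require Import finmap zify.

Set Implicit Arguments.
Unset Strict Implicit.
Unset Printing Implicit Defensive.

Import Order.TTheory GRing.Theory Num.Theory.

Lemma exists_max_label (T : finType) (h : T -> int) (V : {set T}) :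
  V != set0 -> exists2 x, x \in V & {in V, forall y, (h y <= h x)%R}.
Proof.
by case/set0Pn=> x0 Vx0; case: (arg_maxP h Vx0) => x Vx xmax; exists x.
Qed.

Lemma exists_strict_max_label (T : finType) (h : T -> int) (V : {set T}) :
  injective h -> V != set0 ->
  exists2 x, x \in V & {in V :\ x, forall y, (h y < h x)%R}.
Proof.
move=> h_inj /(exists_max_label h)[x Vx xmax]; exists x => // y.
rewrite in_setD1 => /andP[yx Vy]; rewrite lt_neqAle xmax // andbT.
by rewrite (inj_eq h_inj).
Qed.

(** If the sums agreed, [u < x] would force [v > y], and [v < x] would force [u > y]. *)
Lemma sum_neq_top (x y u v : int) :
  (u < x)%R -> (v < x)%R -> (u <= y)%R \/ (v <= y)%R -> (u + v != x + y)%R.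
Proof. lia. Qed.

Section LowerBound.

Variables (T : finType) (h : T -> int).
Hypothesis h_inj : injective h.

(** [E] only has to contain these sums. Hence, once a vertex is deleted, any element of [E] that is
    no sum of remaining vertices may be discarded. *)
Definition cross_sums (V A B : {set T}) (E : {fset int}) :=
  forall x y, x \in V -> y \in V -> x != y ->
    ~~ ((x \in A) && (y \in A)) -> ~~ ((x \in B) && (y \in B)) ->
  (h x + h y)%R \in E.

Lemma cross_sumsC V A B E : cross_sums V A B E -> cross_sums V B A E.
Proof. by move=> sE x y Vx Vy xy nB nA; apply: sE. Qed.

(** Let [y] have the largest label outside [A]. Of two remaining vertices with a required sum, one
    lies outside [A], so its label is at most [h y], and the other label is below [h x]. One sum is
    lost, just as [2 * #|V| - #|A|] drops by one. *)
Lemma cross_sums_drop_part (V A B : {set T}) (E : {fset int}) x :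
  A \subset V -> B \subset V -> [disjoint A & B] -> B != set0 ->
  cross_sums V A B E -> x \in A -> {in V :\ x, forall y, (h y < h x)%R} ->
  exists2 E' : {fset int}, #|` E'|.+1 = #|` E|
    & cross_sums (V :\ x) (A :\ x) B E'.
Proof.
move=> sAV sBV dAB /set0Pn[b Bb] sE Ax xmax.
have nA y : y \in B -> y \notin A by move=> By; rewrite (disjointFl dAB).
have /(exists_max_label h)[y] : V :\: A != set0.
  by apply/set0Pn; exists b; rewrite inE nA // (subsetP sBV).
rewrite inE => /andP[yA Vy] ymax.
have yx : y != x by apply: contraNneq yA => ->.
have sxy : (h x + h y)%R \in E.
  apply: sE; [exact: (subsetP sAV)|by []|by rewrite eq_sym|..].
  - by rewrite (negPf yA) andbF.
  - by rewrite (disjointFr dAB Ax).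
exists (E `\ (h x + h y)%R)%fset; first by rewrite (cardfsD1 (h x + h y)%R E) sxy.
move=> u v Vu Vv uv nAuv nBuv.
have [[ux Vu'] [vx Vv']] : (u != x /\ u \in V) /\ (v != x /\ v \in V).
  by split; apply/andP; rewrite -in_setD1.
have nAuv' : ~~ ((u \in A) && (v \in A)).
  by move: nAuv; rewrite !in_setD1 ux vx.
rewrite in_fsetD1 sE // andbT.
apply: sum_neq_top; [exact: xmax|exact: xmax|].
have [Au|Au] := boolP (u \in A); last by left; apply: ymax; rewrite inE Au.
by right; apply: ymax; rewrite inE Vv' andbT; move: nAuv'; rewrite Au.
Qed.

(** Let [y] and [z] carry the next two labels. Of two distinct remaining vertices one differs from
    [y], so its label is at most [h z], and their sum is neither [h x + h y] nor [h x + h z]. Larger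
    parts [A'] and [B'] only relax the requirement on sums; this permits a fresh part when deleting
    [x] empties [A]. *)
Lemma cross_sums_drop_universal (V A B A' B' : {set T}) (E : {fset int}) x :
  x \in V -> {in V :\ x, forall y, (h y < h x)%R} ->
  {in V :\ x, forall y, (h x + h y)%R \in E} ->
  1 < #|V :\ x| -> cross_sums V A B E ->
  {in V :\ x, forall y, y \in A -> y \in A'} ->
  {in V :\ x, forall y, y \in B -> y \in B'} ->
  exists2 E' : {fset int}, #|` E'|.+2 = #|` E|
    & cross_sums (V :\ x) A' B' E'.
Proof.
move=> Vx xmax xE cV sE sA sB.
have [|y Vy ymax] := @exists_strict_max_label _ h (V :\ x) h_inj.
  by rewrite -card_gt0 ltnW.
have [|z Vz zmax] := @exists_strict_max_label _ h (V :\ x :\ y) h_inj.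
  by rewrite -card_gt0; move: cV; rewrite (cardsD1 y) Vy.
have hzy := ymax z Vz.
have Vz' : z \in V :\ x by move: Vz; rewrite in_setD1 => /andP[].
have sxz : (h x + h z)%R \in (E `\ (h x + h y)%R)%fset.
  by rewrite in_fsetD1 xE // andbT (inj_eq (addrI _)) lt_eqF.
exists (E `\ (h x + h y)%R `\ (h x + h z)%R)%fset.
  by rewrite (cardfsD1 (h x + h y)%R E) xE // (cardfsD1 (h x + h z)%R) sxz.
move=> u v Vu Vv uv nA nB.
have [Vu' Vv'] : u \in V /\ v \in V.
  by move: Vu Vv; rewrite !in_setD1 => /andP[_ ->] /andP[_ ->].
have uvE : (h u + h v)%R \in E.
  apply: sE => //.
  - by apply: contra nA => /andP[??]; rewrite !sA.
  - by apply: contra nB => /andP[??]; rewrite !sB.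
have le_z w : w \in V :\ x -> w != y -> (h w <= h z)%R.
  move=> Vw wy; have [->//|wz] := eqVneq w z.
  by apply/ltW/zmax; rewrite in_setD1 wz in_setD1 wy.
have uvz : (h u <= h z)%R \/ (h v <= h z)%R.
  have [uy|uy] := eqVneq u y; last by left; apply: le_z.
  by right; apply: le_z; rewrite // -uy eq_sym.
have uvy : (h u <= h y)%R \/ (h v <= h y)%R.
  by case: uvz => /le_lt_trans/(_ hzy)/ltW; [left|right].
by rewrite !in_fsetD1 uvE andbT !sum_neq_top //; apply: xmax.
Qed.

(** Induction on [#|V|], losing as many sums as [2 * #|V| - #|A| - #|B|] decreases. A one-element
    part excludes no pair, so a part about to become empty can be replaced by another singleton. *)
Lemma cross_sums_card (V A B : {set T}) (E : {fset int}) :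
  A \subset V -> B \subset V -> [disjoint A & B] ->
  A != set0 -> B != set0 -> cross_sums V A B E ->
  2 * #|V| <= #|` E| + #|A| + #|B| + 1.
Proof.
have [m] := ubnP #|V|; elim: m V A B E => // m IH V A B E.
rewrite ltnS => leVm sAV sBV dAB A0 B0 sE.
have [|x Vx xmax] := @exists_strict_max_label _ h V h_inj.
  by case/set0Pn: A0 => a Aa; apply/set0Pn; exists a; apply: (subsetP sAV).
have cV : #|V| = #|V :\ x|.+1 by rewrite (cardsD1 x V) Vx.
have ltVm : #|V :\ x| < m by rewrite -ltnS -cV.
(* The claim is symmetric in [A] and [B], and by disjointness [x] misses one of them. *)
wlog nBx : A B sAV sBV dAB A0 B0 sE / x \notin B.
  move=> wlg; have [Bx|] := boolP (x \in B); last exact: wlg.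
  rewrite [_ + #|A| + _]addnAC; apply: wlg => //.
  - by rewrite disjoint_sym.
  - exact: cross_sumsC.
  - by rewrite (disjointFl dAB Bx).
have sBVx : B \subset V :\ x by rewrite subsetD1 sBV.
have nAB y : y \in B -> y \notin A by move=> By; rewrite (disjointFl dAB).
have [b Bb] := set0Pn _ B0.
have [Ax|nAx] := boolP (x \in A); last first.
  have sAVx : A \subset V :\ x by rewrite subsetD1 sAV.
  have [a Aa] := set0Pn _ A0.
  have [||E' cE' sE'] := @cross_sums_drop_universal V A B A B E x Vx xmax _ _ sE
      (fun _ _ => id) (fun _ _ => id).
  - move=> y; rewrite in_setD1 => /andP[yx Vy].
    by apply: sE; rewrite // 1?eq_sym ?(negPf nAx) ?(negPf nBx).
  - apply: leq_trans (subset_leq_card (A := [set a; b]) _).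
      by rewrite cards2; case: eqVneq Aa => // ->; rewrite (negPf (nAB _ Bb)).
    by apply/subsetP=> y /set2P[]->; [apply: (subsetP sAVx)|apply: (subsetP sBVx)].
  have := IH _ _ _ _ ltVm sAVx sBVx dAB A0 B0 sE'.
  by clear -cV cE'; lia.
have cA : #|A| = #|A :\ x|.+1 by rewrite (cardsD1 x A) Ax.
have [A1|A1] := eqVneq (A :\ x) set0; last first.
  have [E' cE' sE'] := cross_sums_drop_part sAV sBV dAB B0 sE Ax xmax.
  have := IH _ _ _ _ ltVm (setSD _ sAV) sBVx _ A1 B0 sE'.
  have dAB' : [disjoint A :\ x & B] by apply: disjointWl dAB; apply: subD1set.
  by move=> /(_ dAB'); clear -cV cA cE'; lia.
have nAVx y : y \in V :\ x -> y \notin A.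
  rewrite in_setD1 => /andP[yx _]; apply/negP => Ay.
  by have := in_set0 y; rewrite -A1 in_setD1 yx Ay.
have xE : {in V :\ x, forall y, (h x + h y)%R \in E}.
  move=> y Vxy; have := Vxy; rewrite in_setD1 => /andP[yx Vy].
  by apply: sE; rewrite // 1?eq_sym ?(negPf nBx) // (negPf (nAVx _ Vxy)) andbF.
(* If only [B] remains, no vertex is left to form a new part, but the [#|B|] distinct sums at [x]
   already give the bound. *)
have [VB|] := boolP (V :\ x \subset B).
  have {VB} VB : V :\ x = B by apply/eqP; rewrite eqEsubset VB.
  have : #|B| <= #|` E|.
    rewrite cardE -(size_map (fun y => h x + h y)%R); apply: uniq_leq_size.
      by rewrite map_inj_uniq ?enum_uniq // => y z /addrI /h_inj.
    by move=> s /mapP[y]; rewrite mem_enum -VB => Vy {s}->; apply: xE.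
  by rewrite cV cA A1 cards0 VB; move: #|B| #|` E| => p q; clear; lia.
case/subsetPn=> z Vz nBz.
(* x is the only vertex of A, hence universal like z: exchange their roles. *)
have [||E' cE' sE'] := @cross_sums_drop_universal V A B [set z] B E x Vx xmax xE _ sE
  _ (fun _ _ => id).
- apply: leq_trans (subset_leq_card (A := [set z; b]) _).
    by rewrite cards2; case: eqVneq Bb => // <-; rewrite (negPf nBz).
  by apply/subsetP=> y /set2P[]->; [|apply: (subsetP sBVx)].
- by move=> y /nAVx /negPf->.
have := IH _ [set z] B _ ltVm _ sBVx _ _ B0 sE'.
rewrite sub1set disjoints1 cards1 cA A1 cards0 -card_gt0 cards1 cV Vz nBz.
by move=> /(_ isT isT isT); clear -cE'; lia.
Qed.

End LowerBound.

(** Cardinality and injectivity make [f] a bijection onto [0, ..., N - 1]. The upper bound is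
    written additively to avoid truncated subtraction. *)
Definition band_labeling (a b N : nat) (G : sgraph) (f : G -> nat) :=
  [/\ #|G| = N, injective f, forall u, f u < N
    & forall u v, adj u v =
        [&& u != v, a <= f u + f v & f u + f v + b + 2 <= 2 * N]].

Lemma card_label_interval (T : finType) (f : T -> nat) (m d : nat) :
  injective f -> #|[set x | m <= f x < m + d]| <= d.
Proof.
move=> f_inj; rewrite cardE -(size_map f) -[leqRHS](size_iota m).
apply: uniq_leq_size; first by rewrite map_inj_uniq ?enum_uniq.
by move=> s /mapP[x]; rewrite mem_enum inE mem_iota => xP {s}->.
Qed.

Lemma sum_index_band (a b N : nat) (G : sgraph) (f : G -> nat) :
  0 < a -> 0 < b -> a + b <= N -> band_labeling a b N f ->
  sum_index G = 2 * N - a - b - 1.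
Proof.
move=> a_gt0 b_gt0 abN [cG f_inj f_lt f_adj]; apply/eqP; rewrite eqn_leq.
apply/andP; split.
  apply: leq_trans (sum_index_le (f := fun u => Posz (f u)) _) _.
    by move=> u v [] /f_inj.
  rewrite -[leqRHS](size_iota a) -(size_map Posz).
  apply: uniq_leq_size; first exact: fset_uniq.
  move=> s /mem_edge_sums[u [v [uv {s}->]]].
  rewrite -PoszD map_f // mem_iota; move: uv; rewrite f_adj.
  by case/and3P; lia.
have [h h_inj <-] := sum_index_attained G.
(* The optimal labeling is [h]; from here on [f] only describes the structure of [G]. *)
pose A := [set x : G | f x < a]; pose B := [set x : G | N - b <= f x].
have cA : #|A| <= a by apply: (card_label_interval 0 a f_inj).
have cB : #|B| <= b.
  apply: leq_trans (card_label_interval (N - b) b f_inj).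
  apply: subset_leq_card; apply/subsetP => x; rewrite !inE => ->.
  by have := f_lt x; lia.
(* Bounding the complements as well forces [#|A| = a] and [#|B| = b], so both parts are nonempty. *)
have cAC : #|~: A| <= N - a.
  apply: leq_trans (card_label_interval a (N - a) f_inj).
  apply: subset_leq_card; apply/subsetP => x; rewrite !inE -leqNgt => ->.
  by have := f_lt x; lia.
have cBC : #|~: B| <= N - b.
  apply: leq_trans (card_label_interval 0 (N - b) f_inj).
  by apply: subset_leq_card; apply/subsetP => x; rewrite !inE -ltnNge.
have := cardsC A; have := cardsC B; rewrite cG => cBN cAN.
have := @cross_sums_card G h h_inj [set: G] A B (edge_sums h).
rewrite cardsT cG !subsetT -!card_gt0.
suff [dAB sE] : [disjoint A & B] /\ cross_sums h [set: G] A B (edge_sums h).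
  by move=> /(_ isT isT dAB _ _ sE); lia.
split.
  by rewrite disjoint_subset; apply/subsetP => x; rewrite !inE; lia.
move=> x y _ _ xy; rewrite !inE => nA nB.
apply/mem_edge_sums; exists x, y; split=> //.
(* Not both in [A]: one label is at least [a]. Not both in [B]: one label is at most [N - b - 1],
   the other at most [N - 1]. *)
by rewrite f_adj xy /=; have := f_lt x; have := f_lt y; lia.
Qed.

Definition L_join_label (a b : nat) (x : graph_join (L_graph a) (L_graph b)) : nat :=
  match x with inl i => i : nat | inr j => a + b - j.+1 end.

(** Reversing the second graph turns its lower threshold [b + 2] on index sums into the upper bound
    [2 * (a + b) - b - 2] on label sums. *)
Lemma L_join_band (a b : nat) : band_labeling a b (a + b) (@L_join_label a b).
Proof.
split.
- by rewrite card_sum !card_ord.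
- move=> [i|i] [j|j] /= ij; have := ltn_ord i; have := ltn_ord j => ltj lti.
  + by congr inl; apply: val_inj.
  + lia.
  + lia.
  + by congr inr; apply: val_inj => /=; lia.
- by move=> [i|i] /=; have := ltn_ord i; lia.
- move=> [i|i] [j|j] /=; have := ltn_ord i; have := ltn_ord j => ltj lti;
    rewrite /L_adj ?(inj_eq inl_inj) ?(inj_eq inr_inj) -?val_eqE /=; lia.
Qed.

Definition insert_label (b N m : nat) (G : sgraph) (f : G -> nat)
    (x : graph_join G (complete_graph m)) : nat :=
  match x with
  | inl u => if f u < N - b then f u else f u + m
  | inr i => N - b + i
  end.

(** The upper bound can fail only for two of the top [b] labels, whose sum moves by [2 * m] along
    with the bound. The lower bound can fail only for two labels below [a], which stay fixed since
    [a <= N - b]. The clique labels lie between these ranges. *)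
Lemma insert_band (a b N m : nat) (G : sgraph) (f : G -> nat) :
  a + b <= N -> band_labeling a b N f ->
  band_labeling a b (N + m) (@insert_label b N m G f).
Proof.
move=> abN [cG f_inj f_lt f_adj]; split.
- by rewrite card_sum cG card_ord.
- move=> [u|i] [v|j] /= uv.
  + by congr inl; apply: f_inj; move: uv; case: ifP; case: ifP; lia.
  + by move: uv; have := ltn_ord j; case: ifP; lia.
  + by move: uv; have := ltn_ord i; case: ifP; lia.
  + by congr inr; apply: val_inj => /=; lia.
- move=> [u|i] /=; last by have := ltn_ord i; lia.
  by have := f_lt u; case: ifP; lia.
- move=> [u|i] [v|j] /=; rewrite ?(inj_eq inl_inj) ?(inj_eq inr_inj).
  + rewrite f_adj -(inj_eq f_inj); have := f_lt u; have := f_lt v.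
    by case: ifP; case: ifP; lia.
  + by have := f_lt u; have := ltn_ord j; case: ifP; lia.
  + by have := f_lt v; have := ltn_ord i; case: ifP; lia.
  + by rewrite /complete_adj -val_eqE /=; have := ltn_ord i; have := ltn_ord j; lia.
Qed.

Lemma foldl_join_band (a b N : nat) (G : sgraph) (f : G -> nat) (s : seq nat) :
  a + b <= N -> band_labeling a b N f ->
  exists f', @band_labeling a b (N + sumn s)
    (foldl graph_join G [seq complete_graph m | m <- s]) f'.
Proof.
elim: s N G f => [|m s IH] N G f abN fP /=; first by exists f; rewrite addn0.
rewrite addnA; exact: IH (leq_trans abN (leq_addr _ _)) (insert_band m abN fP).
Qed.

Theorem theorem2p2 (k : nat) (n : nat -> nat)
    (hk : 2 <= k)
    (n_pos : forall i : nat, 1 <= i <= k -> 0 < n i)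
    (n_noninc : forall i j : nat, 1 <= i -> i <= j -> j <= k -> n j <= n i) :
  let N : nat := \sum_(1 <= i < k.+1) n i in
  Posz (sum_index
    (foldl graph_join (graph_join (L_graph (n 1)) (L_graph (n 2)))
       [seq complete_graph (n i) | i <- index_iota 3 k.+1]))
  = (2%:Z * N%:Z - (n 1%N)%:Z - (n 2%N)%:Z - 1)%R.
Proof.
move=> N.
have n1_gt0 : 0 < n 1 by apply: n_pos; lia.
have n2_gt0 : 0 < n 2 by apply: n_pos; lia.
have [f fP] := foldl_join_band [seq n i | i <- index_iota 3 k.+1] (leqnn _)
  (L_join_band (n 1) (n 2)).
have NE : N = n 1 + n 2 + sumn [seq n i | i <- index_iota 3 k.+1].
  by rewrite /N big_ltn 1?ltnW // big_ltn // addnA sumnE big_map.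
rewrite -NE in fP.
have leN : n 1 + n 2 <= N by rewrite NE leq_addr.
rewrite (map_comp complete_graph n) (sum_index_band n1_gt0 n2_gt0 leN fP).
(* The two facts kept ensure that the natural-number subtractions do not truncate. *)
by clear -leN n1_gt0; lia.
Qed.
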